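(* Let $n\ge 2$ and $\delta\ge 1$ be integers and let $p$ be a prime number. Then there exist a finite field $\mathbb{F}$ of characteristic $p$ and a strongly MDS convolutional code over $\mathbb{F}$ with parameters $(n,n-1,\delta)$.
   Context: Let $\mathbb{F}$ be a finite field, $\mathbb{F}[D]$ the polynomial ring and $\mathbb{F}(\!(D)\!)$ the field of formal Laurent series $\sum_{j\ge l}a_jD^j$. For $1\le k<n$, a convolutional code of rate $k/n$ is a set $\mathcal{C}=\{uG\mid u\in\mathbb{F}(\!(D)\!)^k\}\subseteq\mathbb{F}(\!(D)\!)^n$ with $G\in\mathbb{F}[D]^{k\times n}$ of rank $k$; $G$ is called a generator matrix of $\mathcal{C}$. A polynomial matrix is basic if it has a polynomial right inverse; a polynomial generator matrix is minimal if the sum of its row degrees is minimal among all polynomial generator matrices of $\mathcal{C}$. Every code has a generator matrix that is both minimal and basic, and the degree $\delta$ of $\mathcal{C}$ is the sum of the row degrees of such a matrix. A code of rate $k/n$ and degree $\delta$ is called an $(n,k,\delta)$-code. For $w\in\mathbb{F}^N$, $\mathrm{wt}(w)$ is the number of nonzero coordinates. For $v=\sum_j v_jD^j\in\mathbb{F}(\!(D)\!)^n\setminus\{0\}$ the delay of $v$ is $\min\{j\mid v_j\ne0\}$, and $v_{[m,M]}:=(v_m,\dots,v_M)$. For $j\ge 0$ the $j$th column distance of $\mathcal{C}$ is $d^c_j:=\min\{\mathrm{wt}(v_{[0,j]})\mid v\in\mathcal{C},\ \text{delay of }v\text{ equals }0\}$. An $(n,k,\delta)$-code is strongly MDS if $d^c_M=(n-k)\left(\lfloor\frac{\delta}{k}\rfloor+1\right)+\delta+1$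 for $M=\lfloor\frac{\delta}{k}\rfloor+\lceil\frac{\delta}{n-k}\rceil$. *)

(* Defs.v *)
From mathcomp Require Import all_boot all_order all_algebra.

Set Implicit Arguments.
Unset Strict Implicit.
Unset Printing Implicit Defensive.

Import Order.TTheory GRing.Theory Num.Theory.
Local Open Scope ring_scope.

(* The carrier of F((D)): a_j is the coefficient of D^j.  Two series are
   compared coefficientwise, never through the bound carried by the record. *)
Record laurent (F : finFieldType) := Laurent {
  lcoef :> int -> F;
  lcoef_bounded : exists l : int, forall j : int, j < l -> lcoef j = 0
}.

Section ConvolutionalCodes.
Variable F : finFieldType.

(* The coefficient of D^j in the product g * a. *)
Definition poly_laurent_coef (g : {poly F}) (a : laurent F) (j : int) : F :=
  \sum_(i < size g) g`_i * a (j - i%:Z).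

Definition is_product (k n : nat) (u : 'I_k -> laurent F)
    (G : 'M[{poly F}]_(k, n)) (v : 'I_n -> laurent F) : Prop :=
  forall (c : 'I_n) (j : int),
    v c j = \sum_(r < k) poly_laurent_coef (G r c) (u r) j.

(* A subset of F((D))^n. *)
Definition series_set (n : nat) := ('I_n -> laurent F) -> Prop.

(* The rank is taken over the field F(D) of rational functions. *)
Definition generator_matrix (k n : nat) (C : series_set n)
    (G : 'M[{poly F}]_(k, n)) : Prop :=
  \rank (map_mx (@tofrac {poly F}) G) = k /\
  forall v, C v <-> exists u : 'I_k -> laurent F, is_product u G v.

Definition convolutional_code (k n : nat) (C : series_set n) : Prop :=
  (1 <= k < n)%N /\ exists G : 'M[{poly F}]_(k, n), generator_matrix C G.

Definition basic (k n : nat) (G : 'M[{poly F}]_(k, n)) : Prop :=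
  exists H : 'M[{poly F}]_(n, k), G *m H = 1%:M.

Definition row_degree (k n : nat) (G : 'M[{poly F}]_(k, n)) (r : 'I_k) : nat :=
  \max_(c < n) (size (G r c)).-1.

Definition sum_row_degrees (k n : nat) (G : 'M[{poly F}]_(k, n)) : nat :=
  (\sum_(r < k) row_degree G r)%N.

Definition minimal_generator (k n : nat) (C : series_set n)
    (G : 'M[{poly F}]_(k, n)) : Prop :=
  generator_matrix C G /\
  forall G' : 'M[{poly F}]_(k, n), generator_matrix C G' ->
    (sum_row_degrees G <= sum_row_degrees G')%N.

Definition has_degree (k n : nat) (C : series_set n) (delta : nat) : Prop :=
  exists G : 'M[{poly F}]_(k, n),
    [/\ minimal_generator C G, basic G & sum_row_degrees G = delta].

Definition nkd_code (n k delta : nat) (C : series_set n) : Prop :=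
  convolutional_code k C /\ has_degree k C delta.

(* The weight of a block vector (w_0, ..., w_j) in (F^n)^(j+1), stored with
   w_i as its i-th row. *)
Definition wt (m n : nat) (w : 'M[F]_(m, n)) : nat :=
  #|[set ic : 'I_m * 'I_n | w ic.1 ic.2 != 0]|.

Definition initial_segment (n : nat) (v : 'I_n -> laurent F) (j : nat) :
    'M[F]_(j.+1, n) :=
  \matrix_(i < j.+1, c < n) v c (i : nat)%:Z.

Definition has_delay (n : nat) (v : 'I_n -> laurent F) (d : int) : Prop :=
  (exists c, v c d != 0) /\ (forall j : int, j < d -> forall c, v c j = 0).

(* d is the j-th column distance of C, i.e. the minimum defining it. *)
Definition column_distance (n : nat) (C : series_set n) (j d : nat) : Prop :=
  (exists v, [/\ C v, has_delay v 0 & wt (initial_segment v j) = d]) /\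
  (forall v, C v -> has_delay v 0 -> (d <= wt (initial_segment v j))%N).

End ConvolutionalCodes.

(* The ceiling of m / d, for d > 0. *)
Definition ceil_div (m d : nat) : nat := ((m + d.-1) %/ d)%N.

Definition strongly_MDS (F : finFieldType) (n k delta : nat)
    (C : series_set F n) : Prop :=
  nkd_code k delta C /\
  column_distance C
    (delta %/ k + ceil_div delta (n - k))%N
    ((n - k) * (delta %/ k + 1) + delta + 1)%N.

(* Main.v *)
(** Take for C the kernel of a row h = (h_0, ..., h_(n-1)) of polynomials of
    degree delta; write k = n - 1, delta = k q + r with r < k, and M = delta + q,
    so that the required column distance is M + 2.

    The coefficient of D^m in h_c is a^((n (m+1) - c)^2).  Numbering the columns
    of the sliding parity check matrix by s = n b + c (b the time, c the
    coordinate), its (i, s) entry is then a^((n (i+1) - s)^2), or 0 outside a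
    band.  In a minor on the first rows and on columns s_0 < s_1 < ... with
    s_j < n (j+1), the term of the identity permutation is not zero, and by the
    rearrangement inequality it is the only one of lowest degree in a.  So all
    these minors are nonzero polynomials in a with integer coefficients and lowest
    coefficient 1, and some a in a large enough field of characteristic p is a
    root of none of them.

    Column distance: if v in C has delay 0 and at most M + 1 nonzero entries in
    the window, then an initial part of its support satisfies s_j < n (j+1) and
    no later entry affects the corresponding rows, so v vanishes there.

    Degree: the minor on the first M + 1 columns says that every polynomial of
    degree at most M is h w for a unique w supported on these columns.  This
    gives a Bezout relation b h = 1 and k rows G of degrees q + 1 (r times) and q
    (k - r times) in the kernel of h, with unitriangular leading coefficients.  For
    any generator matrix G', det (b over G') h_c is up to sign the maximal minor of
    G' without column c, so the row degrees of G' add up to at least delta; for G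
    equality forces det (b over G) to be a nonzero constant, whence G is basic and
    generates C. *)

Require Import Defs.
From mathcomp Require Import all_boot all_order all_algebra.
From mathcomp Require Import all_fingroup all_field.
From mathcomp Require Import zify ring.

Set Implicit Arguments.
Unset Strict Implicit.
Unset Printing Implicit Defensive.

Import GRing.Theory.

(** * Rearrangement inequality *)

Lemma ltn_exchange x y u v : x < y -> u < v -> x * v + y * u < x * u + y * v.
Proof.
move=> xy uv; have [d ->] : exists d, y = x + d.+1 by exists (y - x.+1); lia.
have [e ->] : exists e, v = u + e.+1 by exists (v - u.+1); lia.
by rewrite !mulnDl !mulnDr !mulSn !mulnS; lia.
Qed.

Section Rearrangement.
Variables (w : nat).
Implicit Type t : 'S_w.

(** The least moved point is sent upwards, and its preimage is larger than it. *)
Lemma perm_inversion t : t != 1%g -> exists i j : 'I_w, i < j /\ t j < t i.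
Proof.
move=> t_neq1.
have [i0 Ni0] : exists i, t i != i.
  apply/existsP; apply: contraNT t_neq1 => /existsPn H.
  by apply/eqP/permP => i; rewrite perm1; apply/eqP; rewrite -[_ == _]negbK H.
case: (@arg_minnP _ i0 (fun i => t i != i) (fun i => i : nat) Ni0) => i Ni mini.
have fixl (j : 'I_w) : j < i -> t j = j.
  by move=> ji; apply/eqP; apply: contraTT ji => /mini; rewrite -leqNgt.
have lt_ti : i < t i.
  rewrite ltn_neqAle eq_sym Ni /= leqNgt; apply/negP => /fixl /perm_inj ti.
  by rewrite ti eqxx in Ni.
exists i, (t^-1%g i); rewrite permKV lt_ti; split=> //.
rewrite ltn_neqAle leqNgt; apply/andP; split.
  apply: contraNneq Ni => /ord_inj {1}->; rewrite permKV.
  by apply/eqP.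
apply/negP => /[dup] /fixl; rewrite permKV => <-; by rewrite ltnn.
Qed.

Variables (a s : 'I_w -> nat).
Hypothesis (a_incr : forall i j : 'I_w, i < j -> a i < a j).
Hypothesis (s_incr : forall i j : 'I_w, i < j -> s i < s j).

(** Exchanging the values at an inversion strictly increases the sum, so a maximising permutation
    has no inversion, and any other one lies strictly below it. *)
Lemma rearrangement t :
  t != 1%g -> \sum_i a i * s (t i) < \sum_i a i * s i.
Proof.
pose f t := \sum_i a i * s (t i).
have f1 : f 1%g = \sum_i a i * s i by apply: eq_bigr => i _; rewrite perm1.
have swap t' : t' != 1%g -> exists t'', f t' < f t''.
  move=> /perm_inversion [i [j [ij tji]]].
  have Nij : j != i by rewrite -val_eqE /= gtn_eqF.
  exists (tperm i j * t')%g; rewrite /f.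
  rewrite [X in X < _](bigD1 i) //= [X in _ + X < _](bigD1 j) //=.
  rewrite [X in _ < X](bigD1 i) //= [X in _ < _ + X](bigD1 j) //=.
  rewrite !permM tpermL tpermR.
  rewrite [X in _ < _ + (_ + X)](eq_bigr (fun l => a l * s (t' l))); last first.
    by move=> l /andP[li lj]; rewrite permM tpermD // eq_sym.
  rewrite !addnA ltn_add2r; exact: ltn_exchange (a_incr ij) (s_incr tji).
case: (@arg_maxnP _ 1%g predT f isT) => m _ maxm tn1.
have [m1|/swap [t' lt_m]] := eqVneq m 1%g; last first.
  by have := maxm t' isT; rewrite /= leqNgt lt_m.
rewrite m1 f1 in maxm.
have [t' lt_t] := swap _ tn1.
exact: leq_trans lt_t (maxm t' isT).
Qed.

End Rearrangement.

(** * Generic minors and the choice of the field *)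

Section Minors.
Local Open Scope ring_scope.

(* With [u = n (m+1) - c] this is the coefficient of D^m in h_c; with
   [u = n (i+1) - s], truncated, it is the (i, s) entry of the sliding parity
   check matrix, the truncated value 0 being the zero part above the band. *)
Definition parity_coef (R : nzRingType) (x : R) (n delta u : nat) : R :=
  if (0 < u <= n * delta.+1)%N then x ^+ (u ^ 2) else 0.

Definition minor_mx (R : nzRingType) (x : R) (n delta w : nat)
    (s : 'I_w -> nat) : 'M[R]_w :=
  \matrix_(i, j) parity_coef x n delta (n * i.+1 - s j).

Definition admissible (n w : nat) (s : 'I_w -> nat) : bool :=
  [forall i : 'I_w, forall j : 'I_w, (i < j)%N ==> (s i < s j)%N]
  && [forall j : 'I_w, (s j < n * j.+1)%N].

Lemma admissibleP n w (s : 'I_w -> nat) :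
  reflect ((forall i j : 'I_w, i < j -> s i < s j)%N /\
           (forall j : 'I_w, s j < n * j.+1)%N) (admissible n s).
Proof.
apply: (iffP andP) => -[H1 H2]; split.
- by move=> i j; move/forallP/(_ i)/forallP/(_ j)/implyP: H1.
- exact/forallP.
- by apply/forallP=> i; apply/forallP=> j; apply/implyP/H1.
- exact/forallP.
Qed.

Lemma minor_generic (R : idomainType) (n delta w : nat) (s : 'I_w -> nat) :
  (n.-1 * w.-1 <= n * delta)%N -> admissible n s ->
  \det (minor_mx ('X : {poly R}) n delta s) != 0.
Proof.
move=> bnd /admissibleP[s_incr s_lt].
have s_ge (j : 'I_w) : (j <= s j)%N.
  case: j => m; elim: m => [//|m IH] lt_m.
  apply: leq_ltn_trans (IH (ltnW lt_m)) _; exact: s_incr.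
(* As [s i >= i], the diagonal index is at most n + (n - 1) i, which [bnd] keeps inside the band. *)
have diag (i : 'I_w) : (0 < n * i.+1 - s i <= n * delta.+1)%N.
  rewrite subn_gt0 s_lt /= leq_subLR mulnS mulnS.
  have := s_ge i; have lt_i := ltn_ord i.
  have : (n.-1 * i <= n.-1 * w.-1)%N by rewrite leq_mul2l; lia.
  case: n bnd s_lt => [|k] /=; first by lia.
  by move: (nat_of_ord i) (s i) => i' si; nia.
pose E (t : 'S_w) := (\sum_(i < w) (n * i.+1 - s (t i)) ^ 2)%N.
pose ok (t : 'S_w) :=
  [forall i : 'I_w, 0 < n * i.+1 - s (t i) <= n * delta.+1]%N.
have E1 t : ok t -> t != 1%g -> (E 1%g < E t)%N.
  move=> /forallP okt tn1.
  have n0 : (0 < n)%N.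
    have [i _] := perm_inversion tn1; have := s_lt i; by case: (n).
  (* [ok] makes the truncated subtraction exact, so the squares expand and only the mixed term
     depends on [t']. *)
  have key t' : ok t' -> (E t' + 2 * \sum_(i < w) (n * i.+1) * s (t' i) =
      \sum_(i < w) (n * i.+1) ^ 2 + \sum_i (s i) ^ 2)%N.
    move=> /forallP okt'.
    rewrite [X in _ = (_ + X)%N](reindex_inj (@perm_inj _ t')) /=.
    rewrite big_distrr /= -!big_split /=; apply: eq_bigr => i _.
    have /andP[H _] := okt' i.
    by move: (n * _)%N (s _) H => x y; nia.
  have ok1 : ok 1%g by apply/forallP => i; rewrite perm1 diag.
  have := key _ ok1; rewrite [X in (2 * X)%N](_ : _ = \sum_(i < w) (n * i.+1) * s i)%N;
    last by apply: eq_bigr => i _; rewrite perm1.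
  have := key _ (introT forallP okt).
  have a_incr (i j : 'I_w) : (i < j)%N -> (n * i.+1 < n * j.+1)%N.
    by rewrite ltn_mul2l n0 ltnS.
  have := rearrangement a_incr s_incr tn1.
  move: (\sum_i _)%N (\sum_i _)%N; lia.
have prodE t : ok t -> \prod_i minor_mx ('X : {poly R}) n delta s i (t i) = 'X^(E t).
  move=> /forallP okt; rewrite /E expr_sum; apply: eq_bigr => i _.
  by rewrite mxE /parity_coef okt.
have ok1 : ok 1%g by apply/forallP => i; rewrite perm1 diag.
suff: (\det (minor_mx ('X : {poly R}) n delta s))`_(E 1%g) != 0.
  by apply: contraNneq => ->; rewrite coef0.
rewrite /determinant coef_sum (bigD1 1%g) //= prodE // odd_perm1 expr0 mul1r.
rewrite coefXn eqxx [X in _ + X]big1 ?addr0 ?oner_neq0 // => t tn1.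
have [okt|] := boolP (ok t).
  rewrite prodE // -signr_odd; have := E1 _ okt tn1.
  rewrite ltn_neqAle => /andP[/negbTE Ne _].
  by case: (odd _); rewrite ?expr0 ?expr1 ?mul1r ?mulN1r ?coefN coefXn Ne ?oppr0.
rewrite negb_forall => /existsP[i /negbTE Ni].
by rewrite (bigD1 i) //= mxE /parity_coef Ni mul0r mulr0 coef0.
Qed.

Lemma map_minor_mx (R S : nzRingType) (f : {rmorphism R -> S}) (x : R) n delta w (s : 'I_w -> nat) :
  map_mx f (minor_mx x n delta s) = minor_mx (f x) n delta s.
Proof.
apply/matrixP=> i j; rewrite !mxE /parity_coef.
by case: ifP => _; rewrite ?rmorphXn ?rmorph0.
Qed.

(** A nonzero polynomial has fewer roots than its size, so a field of order [p ^ (size P).+1]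
    suffices. The field depends on [P], hence the assumption over every field. *)
Lemma exists_finField_nonroot (p : nat) (P : {poly int}) : prime p ->
  (forall F : fieldType, map_poly (intr : int -> F) P != 0) ->
  exists (F : finFieldType) (a : F),
    p \in [pchar F] /\ (map_poly (intr : int -> F) P).[a] != 0.
Proof.
move=> pr_p P_neq0.
have [F pF cF] := pPrimePowerField pr_p (ltn0Sn (size P)).
suff: exists a : F, (map_poly (intr : int -> F) P).[a] != 0.
  by case=> a Pa; exists F, a.
apply/existsP; apply: contraT => /existsPn H.
have := max_poly_roots (P_neq0 F) _ (enum_uniq F).
rewrite -cardE cF ltnNge => /(_ _)/negP[].
  by apply/allP => a _; rewrite /root -[_ == _]negbK H.
apply: leq_trans (size_poly _ _) _.
by rewrite (leq_trans (leqnSn _)) // ltnW // ltn_expl // prime_gt1.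
Qed.

Lemma exists_superregular (p n delta M : nat) :
  prime p -> (n.-1 * M <= n * delta)%N ->
  exists (F : finFieldType) (a : F), p \in [pchar F] /\
    forall w (s : 'I_w -> nat), (w <= M.+1)%N -> admissible n s ->
      \det (minor_mx a n delta s) != 0.
Proof.
move=> pr_p bnd.
(* A single polynomial for all minors up to order M + 1; admissibility bounds [s] by n (M + 1), so
   the product is finite. A generic [R] lets [P int] reduce to [P F]. *)
pose P (R : comNzRingType) : {poly R} := \prod_(w < M.+2)
  \prod_(s : {ffun 'I_w -> 'I_(n * M.+1).+1} | admissible n (fun i => s i))
    \det (minor_mx ('X : {poly R}) n delta (fun i => s i)).
have mapP (F : fieldType) : map_poly (intr : int -> F) (P int) = P F.
  rewrite rmorph_prod; apply: eq_bigr => w _; rewrite rmorph_prod.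
  by apply: eq_bigr => s _; rewrite -det_map_mx map_minor_mx /= map_polyX.
have [F|F [a [pF Pa]]] := @exists_finField_nonroot p (P int) pr_p.
  rewrite mapP; apply/prodf_neq0 => w _; apply/prodf_neq0 => s; apply: minor_generic.
  by apply: leq_trans bnd; rewrite leq_mul2l; have := ltn_ord w; lia.
exists F, a; split=> // w s le_w /[dup] adm /admissibleP[_ s_lt].
move: Pa; rewrite mapP horner_prod => /prodf_neq0/(_ (Ordinal (le_w : w < M.+2)%N) isT).
rewrite horner_prod => /prodf_neq0.
pose s' : {ffun 'I_w -> 'I_(n * M.+1).+1} := [ffun i => inord (s i)].
have s'E i : s' i = s i :> nat.
  rewrite ffunE inordK // ltnS ltnW // (leq_trans (s_lt i)) // leq_mul2l ltnS.
  by rewrite -ltnS (leq_trans (ltn_ord i)) ?orbT.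
have adm' : admissible n (fun i => s' i).
  by apply/admissibleP; split=> [i j|j]; rewrite !s'E //; have/admissibleP[H _] := adm; apply: H.
move=> /(_ s' adm'); rewrite -horner_evalE -det_map_mx map_minor_mx /= horner_evalE hornerX.
congr (\det _ != 0); apply/matrixP=> i j; by rewrite !mxE s'E.
Qed.

End Minors.

(** * Products of polynomials and series *)

Section PolynomialAction.
Local Open Scope ring_scope.
Variable F : finFieldType.
Implicit Types (g h : {poly F}) (a b : int -> F).

(** The convolution in [poly_laurent_coef], on bare functions, so that intermediate series need no
    proof of boundedness. *)
Definition poly_act g a (j : int) : F := \sum_(i < size g) g`_i * a (j - i%:Z).

Lemma poly_actE N g a j : (size g <= N)%N ->
  poly_act g a j = \sum_(i < N) g`_i * a (j - i%:Z).
Proof.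
move=> le_N; rewrite /poly_act (big_ord_widen N (fun i => g`_i * a (j - i%:Z))) //.
rewrite big_mkcond; apply: eq_bigr => i _.
by case: ltnP => // /(nth_default 0) ->; rewrite mul0r.
Qed.

Lemma poly_actD g h a j : poly_act (g + h) a j = poly_act g a j + poly_act h a j.
Proof.
rewrite !(@poly_actE (maxn (size g) (size h))) ?leq_maxl ?leq_maxr ?size_polyD //.
by rewrite -big_split; apply: eq_bigr => i _; rewrite coefD mulrDl.
Qed.

Lemma poly_act0 a j : poly_act 0 a j = 0.
Proof. by rewrite /poly_act size_poly0 big_ord0. Qed.

Lemma poly_actC c a j : poly_act c%:P a j = c * a j.
Proof. by rewrite (@poly_actE 1) ?size_polyC_leq1 // big_ord1 coefC subr0. Qed.

Lemma poly_actMX g a j : poly_act (g * 'X) a j = poly_act g a (j - 1).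
Proof.
rewrite (@poly_actE (size g).+1).
  rewrite big_ord_recl coefMX mul0r add0r; apply: eq_bigr => i _.
  by rewrite coefMX /=; congr (_ * a _); rewrite /bump /=; lia.
by rewrite (leq_trans (size_polyMleq _ _)) // size_polyX addn2.
Qed.

Lemma poly_act_suml (I : finType) (g : I -> {poly F}) a j :
  poly_act (\sum_r g r) a j = \sum_r poly_act (g r) a j.
Proof.
by apply: (big_morph (fun p => poly_act p a j)) => [x y|]; rewrite ?poly_actD ?poly_act0.
Qed.

Lemma poly_act_sumr (I : finType) g (a : I -> int -> F) j :
  poly_act g (fun j => \sum_r a r j) j = \sum_r poly_act g (a r) j.
Proof. by rewrite exchange_big; apply: eq_bigr => i _; rewrite mulr_sumr. Qed.

Lemma eq_poly_act g a b : a =1 b -> poly_act g a =1 poly_act g b.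
Proof. by move=> ab j; apply: eq_bigr => i _; rewrite ab. Qed.

Lemma poly_actM g h a j : poly_act (g * h) a j = poly_act g (poly_act h a) j.
Proof.
elim/poly_ind: g j => [|g c IH] j; first by rewrite mul0r !poly_act0.
rewrite mulrDl -mulrA ['X * h]mulrC mulrA !poly_actD !poly_actMX IH; congr (_ + _).
rewrite poly_actC (@poly_actE (size h)).
  by rewrite mulr_sumr; apply: eq_bigr => i _; rewrite coefCM mulrA.
by rewrite mul_polyC size_scale_leq.
Qed.

Definition poly_series g (j : int) : F := if j is Posz m then g`_m else 0.

Lemma poly_series_sum (I : finType) (g : I -> {poly F}) j :
  poly_series (\sum_r g r) j = \sum_r poly_series (g r) j.
Proof. by case: j => m /=; [rewrite coef_sum | rewrite big1]. Qed.

Lemma poly_series_inj g h : poly_series g =1 poly_series h -> g = h.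
Proof. by move=> gh; apply/polyP => i; apply: (gh i%:Z). Qed.

Lemma poly_act_series g h j : poly_act g (poly_series h) j = poly_series (g * h) j.
Proof.
have shift p i : poly_series (p * 'X) i = poly_series p (i - 1).
  case: i => [[|i]|i] //=; rewrite ?coefMX //=.
  by rewrite subn1 /=.
elim/poly_ind: g j => [|g c IH] j.
  by rewrite mul0r poly_act0; case: j => //= m; rewrite coef0.
rewrite poly_actD poly_actMX IH poly_actC -shift mulrDl [in RHS]mulrAC.
by case: j => m /=; rewrite ?coefD ?coefCM ?mulr0 ?addr0.
Qed.

Lemma poly_act_bounded g a l :
  (forall j, j < l -> a j = 0) -> forall j, j < l -> poly_act g a j = 0.
Proof.
move=> a0 j jl; rewrite /poly_act big1 // => i _; rewrite a0 ?mulr0 //.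
lia.
Qed.

Definition series_of_poly g : laurent F.
Proof. by exists (poly_series g); exists 0 => -[]. Defined.

Lemma common_bound n (v : 'I_n -> laurent F) :
  exists l : int, forall c j, j < l -> v c j = 0.
Proof.
have [l vl] := fin_all_exists (fun c => lcoef_bounded (v c)).
exists (- \sum_c `|l c|) => c j jl; apply: vl; apply: Order.POrderTheory.lt_le_trans jl _.
rewrite (bigD1 c) //= Num.Theory.lerNl (Order.POrderTheory.le_trans (Num.Theory.ler_norm _)) //.
by rewrite Num.Theory.normrN Num.Theory.lerDl Num.Theory.sumr_ge0.
Qed.

End PolynomialAction.

(** * Codes given by a parity check *)

Section ParityCode.
Local Open Scope ring_scope.
Variables (F : finFieldType) (n : nat) (h : 'cV[{poly F}]_n).

Definition parity_code : series_set F n :=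
  fun v => forall j, \sum_c poly_act (h c 0) (v c) j = 0.

Lemma parity_code_poly (w : 'rV[{poly F}]_n) :
  parity_code (fun c => series_of_poly (w 0 c)) <-> w *m h = 0.
Proof.
have E j : \sum_c poly_act (h c 0) (series_of_poly (w 0 c)) j =
    poly_series ((w *m h) 0 0) j.
  rewrite mxE poly_series_sum; apply: eq_bigr => c _.
  by rewrite [LHS]poly_act_series mulrC.
split=> [wC|w0 j]; last by rewrite E w0 mxE; case: j => //= m; rewrite coef0.
apply/matrixP => i j; rewrite !ord1 [RHS]mxE; apply: poly_series_inj => l.
by rewrite -E wC; case: l => //= m; rewrite coef0.
Qed.

Lemma generator_parity k (G : 'M[{poly F}]_(k, n)) :
  generator_matrix parity_code G -> G *m h = 0.
Proof.
case=> _ genG; apply/row_matrixP => r; rewrite row_mul row0.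
apply/parity_code_poly/genG; exists (fun r' => series_of_poly (r' == r)%:R) => c j.
rewrite [RHS](eq_bigr (fun r' => poly_series (G r' c * (r' == r)%:R) j)).
  rewrite -poly_series_sum (bigD1 r) //= big1 ?addr0 ?eqxx ?mulr1 ?mxE //.
  by move=> i /negbTE ->; rewrite mulr0.
by move=> r' _; rewrite -poly_act_series.
Qed.

(** If v h = 0, the last identity gives v = (v H) G, so v H is an input producing v; the right
    inverse [H] gives the rank. *)
Lemma parity_generator k (G : 'M[{poly F}]_(k, n)) (H : 'M_(n, k)) (b : 'rV_n) :
  G *m h = 0 -> G *m H = 1%:M -> H *m G + h *m b = 1%:M ->
  generator_matrix parity_code G.
Proof.
move=> Gh GH HG; split.
  apply/eqP/row_freeP; exists (map_mx (@tofrac _) H).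
  by rewrite -map_mxM GH map_mx1.
move=> v; split=> [vC|[u uv] j].
  have [l vl] := common_bound v.
  have ub r : exists l : int, forall j, j < l -> \sum_c poly_act (H c r) (v c) j = 0.
    exists l => j jl; rewrite big1 // => c _.
    by apply: poly_act_bounded jl => i; apply: vl.
  exists (fun r => Laurent (ub r)) => c j.
  transitivity (\sum_c' poly_act ((H *m G + h *m b) c' c) (v c') j).
    rewrite HG (bigD1 c) //= big1 ?addr0 => [|i /negbTE Ni].
      by rewrite !mxE eqxx (poly_actC 1) mul1r.
    by rewrite !mxE Ni poly_act0.
  transitivity (\sum_c' poly_act (b 0 c * h c' 0) (v c') j +
     \sum_r \sum_c' poly_act (G r c * H c' r) (v c') j).
    rewrite [X in _ = _ + X]exchange_big -big_split; apply: eq_bigr => c' _ /=.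
    rewrite !mxE big_ord1 addrC poly_actD poly_act_suml mulrC; congr (_ + _).
    by apply: eq_bigr => r _; rewrite mulrC.
  rewrite (eq_bigr (fun c' => poly_act (b 0 c) (poly_act (h c' 0) (v c')) j)); last first.
    by move=> c' _; rewrite poly_actM.
  rewrite -poly_act_sumr (eq_poly_act _ (b := fun=> 0)) //.
  rewrite {1}/poly_act big1 ?add0r => [|i _]; last by rewrite mulr0.
  apply: eq_bigr => r _; rewrite
    -[RHS]/(poly_act _ (fun j => \sum_c poly_act (H c r) (v c) j) _)
    poly_act_sumr.
  apply: eq_bigr => c' _.
  by rewrite poly_actM.
transitivity (\sum_r poly_act ((G *m h) r 0) (u r) j); last first.
  by rewrite Gh big1 // => r _; rewrite mxE poly_act0.
rewrite (eq_bigr (fun c => \sum_r poly_act (h c 0 * G r c) (u r) j)); last first.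
  move=> c _; rewrite (eq_poly_act _ (uv c)) poly_act_sumr; apply: eq_bigr => r _.
  by rewrite poly_actM.
rewrite exchange_big; apply: eq_bigr => r _; rewrite mxE poly_act_suml.
by apply: eq_bigr => c _; rewrite mulrC.
Qed.

End ParityCode.

(** * Degrees of determinants *)

Section Degrees.
Local Open Scope ring_scope.
Variable F : fieldType.

Lemma size_coef_prod (I : finType) (g : I -> {poly F}) (nu : I -> nat) :
  (forall i, size (g i) <= (nu i).+1)%N ->
  (size (\prod_i g i)%R <= (\sum_i nu i).+1)%N /\
  (\prod_i g i)`_(\sum_i nu i) = \prod_i (g i)`_(nu i).
Proof.
move=> gnu; elim/big_rec3: _ => [|i x d p _ [sp cp]].
  by rewrite size_poly1 coef1.
split.
  apply: leq_trans (size_polyMleq _ _) _.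
  by have := gnu i; lia.
rewrite -cp coefM (bigD1 (Ordinal (leq_addr d (nu i) : nu i < (nu i + d).+1)%N)) //=.
rewrite addKn big1 ?addr0 // => -[j lt_j]; rewrite -val_eqE /= => ne.
have [lt|ge] := ltnP (nu i) j.
  by rewrite nth_default ?mul0r // (leq_trans (gnu i)).
by rewrite [X in _ * X]nth_default ?mulr0 // (leq_trans sp) //; lia.
Qed.

(** Each term of the Leibniz expansion takes one entry per row, so the row bounds add up, and the
    coefficients at these bounds multiply to a determinant of their own. *)
Lemma size_coef_det k (B : 'M[{poly F}]_k) (nu : 'I_k -> nat) :
  (forall i j, size (B i j) <= (nu i).+1)%N ->
  (size (\det B) <= (\sum_i nu i).+1)%N /\
  (\det B)`_(\sum_i nu i) = \det (\matrix_(i, j) (B i j)`_(nu i)).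
Proof.
move=> Bnu; have H s := size_coef_prod (fun i => Bnu i ((s : 'S_k) i)).
split.
  apply: leq_trans (size_sum _ _ _) _; apply/bigmax_leqP => s _.
  by rewrite size_Msign; case: (H s).
rewrite coef_sum; apply: eq_bigr => s _.
rewrite -[(-1) ^+ s](rmorph_sign (@polyC F)) coefCM (proj2 (H s)); congr (_ * _).
by apply: eq_bigr => i _; rewrite mxE.
Qed.

End Degrees.

(** * Minimal and basic generator matrices *)

Section MinimalGenerators.
Local Open Scope ring_scope.
Variables (F : finFieldType) (k delta : nat).
Variables (h : 'cV[{poly F}]_(1 + k)) (b : 'rV[{poly F}]_(1 + k)).
Hypothesis bh : b *m h = 1%:M.
Hypothesis size_h : forall c, size (h c 0) = delta.+1.
Implicit Type G : 'M[{poly F}]_(k, 1 + k).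

Lemma stack_mul G : G *m h = 0 -> col_mx b G *m h = col_mx 1%:M 0.
Proof. by move=> Gh; rewrite mul_col_mx bh Gh. Qed.

(** Cramer's rule: the stacked matrix sends [h] to the first unit vector, so column 0 of its
    adjugate is its determinant times [h]. *)
Lemma det_stack_mul G c : G *m h = 0 ->
  \det (col_mx b G) * h c 0 = (-1) ^+ c * \det (col' c G).
Proof.
move=> /stack_mul Ah; set A := col_mx b G.
have <- : cofactor A 0 c = (-1) ^+ c * \det (col' c G).
  rewrite /cofactor add0n; congr (_ * \det _); apply/matrixP => i j.
  rewrite !mxE; case: splitP => [l|l] /=; rewrite ?[l]ord1 //= /bump /= => -[] il.
  by congr (G _ _); apply: val_inj.
transitivity ((\adj A *m (A *m h)) c 0).
  by rewrite mulmxA mul_adj_mx mul_scalar_mx mxE.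
rewrite Ah mxE big_ord_recl big1 ?addr0 => [|i _].
  rewrite !mxE; case: splitP => // l _; by rewrite ord1 mxE eqxx mulr1.
rewrite !mxE; case: splitP => [l|l _]; last by rewrite mxE mulr0.
by rewrite [l]ord1.
Qed.

(** Multiplying a left kernel vector (v0, v1) by [h] leaves v0 = 0; then v1 kills [G], which has
    full rank. *)
Lemma det_stack_neq0 G : G *m h = 0 ->
  \rank (map_mx (@tofrac {poly F}) G) = k -> \det (col_mx b G) != 0.
Proof.
move=> /stack_mul Ah rG; rewrite -tofrac_eq0 -det_map_mx.
apply/det0P => -[v /negP v_neq0 vA]; apply: v_neq0; move: vA; rewrite map_col_mx -[v]hsubmxK.
move: (lsubmx v) (rsubmx v) => v0 v1 vA.
have v0_0 : v0 = 0.
  have /(congr1 (mulmx (row_mx v0 v1))) := congr1 (map_mx (@tofrac _)) Ah.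
  rewrite map_mxM !map_col_mx mulmxA vA mul0mx mul_row_col map_mx1 mulmx1.
  by rewrite map_mx0 mulmx0 addr0.
move: vA; rewrite v0_0 mul_row_col mul0mx add0r => /eqP.
by rewrite mulmx_free_eq0 /row_free ?rG ?eqxx // => /eqP->; rewrite row_mx0.
Qed.

Lemma size_row_degree m n (G : 'M[{poly F}]_(m, n)) r c :
  (size (G r c) <= (row_degree G r).+1)%N.
Proof.
by rewrite (leq_trans (leqSpred _)) // ltnS; apply: (leq_bigmax (F := fun c => (size (G r c)).-1)).
Qed.

Lemma parity_degree_ge G :
  generator_matrix (parity_code h) G -> (delta <= sum_row_degrees G)%N.
Proof.
move=> /[dup] /generator_parity Gh [rG _].
have d0 := det_stack_neq0 Gh rG.
have h0 c : h c 0 != 0 by rewrite -size_poly_eq0 size_h.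
have [|le_det _] := @size_coef_det F k (col' 0 G) (row_degree G).
  by move=> i j; rewrite mxE size_row_degree.
rewrite -(size_Msign _ (@ord0 k)) -det_stack_mul // size_mul // size_h addnS /= in le_det.
rewrite /sum_row_degrees; move: le_det; have : (0 < size (\det (col_mx b G)))%N by rewrite size_poly_gt0.
by move: (size _) (\sum_i _)%N => s d; lia.
Qed.

Lemma parity_minimal_basic G (nu : 'I_k -> nat) :
  G *m h = 0 ->
  (forall r c, size (G r c) <= (nu r).+1)%N ->
  (\sum_r nu r)%N = delta ->
  \det (\matrix_(r, t) (G r (lift 0 t))`_(nu r)) != 0 ->
  [/\ minimal_generator (parity_code h) G, basic G & sum_row_degrees G = delta].
Proof.
move=> Gh Gnu sum_nu lead.
have h0 c : h c 0 != 0 by rewrite -size_poly_eq0 size_h.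
have detE := det_stack_mul 0 Gh; rewrite expr0 mul1r in detE.
have [|sz_det co_det] := @size_coef_det F k (col' 0 G) nu.
  by move=> i j; rewrite mxE Gnu.
have d0 : \det (col_mx b G) != 0.
  apply: contraNneq lead => d0; move: co_det; rewrite -detE d0 mul0r coef0.
  by move=> e; apply/eqP; rewrite [RHS]e; congr (\det _); apply/matrixP=> i j; rewrite !mxE.
have Aunit : (col_mx b G : 'M_(1 + k)) \in unitmx.
  rewrite unitmxE poly_unitE.
  have sz1 : size (\det (col_mx b G)) = 1%N.
    have : (0 < size (\det (col_mx b G)))%N by rewrite size_poly_gt0.
    move: sz_det; rewrite -detE size_mul // size_h sum_nu addnS /=; move: (size _) => s; lia.
  rewrite sz1 eqxx unitfE; move: d0; rewrite -lead_coef_eq0 /lead_coef sz1.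
  by [].
(* The first column of the inverse is [h], since the stack sends [h] to the first unit vector; the
   other columns [Y] form a right inverse of [G]. *)
pose X := lsubmx (invmx (col_mx b G : 'M_(1 + k)) : 'M_(1 + k, 1 + k)).
pose Y := rsubmx (invmx (col_mx b G : 'M_(1 + k)) : 'M_(1 + k, 1 + k)).
have XY : row_mx X Y = invmx (col_mx b G : 'M_(1 + k)) by rewrite hsubmxK.
have GY : G *m Y = 1%:M.
  have := mulmxV Aunit; rewrite -XY mul_col_row scalar_mx_block.
  by case/eq_block_mx.
have Xh : X = h.
  have := mulKmx Aunit h; rewrite stack_mul // -XY mul_row_col mulmx1 mulmx0 addr0.
  by [].
have YG : Y *m G + h *m b = 1%:M.
  by have := mulVmx Aunit; rewrite -XY mul_row_col Xh addrC.
have gen := parity_generator Gh GY YG.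
have sumG : sum_row_degrees G = delta.
  apply/eqP; rewrite eqn_leq parity_degree_ge // andbT -sum_nu.
  apply: leq_sum => r _; apply/bigmax_leqP => c _.
  by have := Gnu r c; lia.
split=> //; last by exists Y.
by split=> // G' /parity_degree_ge; rewrite sumG.
Qed.

End MinimalGenerators.

(** * The parity check row and its kernel *)

Section ParityRow.
Local Open Scope ring_scope.
Variables (F : finFieldType) (a : F) (k q r : nat).
Hypothesis r_lt : (r < k)%N.
Let n := (1 + k)%N.
Let delta := (k * q + r)%N.
Let M := (delta + q)%N.
Hypothesis superregular : forall w (s : 'I_w -> nat),
  (w <= M.+1)%N -> admissible n s -> \det (minor_mx a n delta s) != 0.

Definition parity_poly (m d c : nat) : {poly F} :=
  \poly_(i < d.+1) parity_coef a m d (m * i.+1 - c).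

(** Column s of the sliding matrix is h_(s mod m) delayed by s div m, each delay lowering the index
    by m. Rows before the delay have truncated index 0; rows past degree d have index above m (d +
    1). *)
Lemma coef_parity_poly_shift (m d s i : nat) : (0 < m)%N ->
  ('X^(s %/ m) * parity_poly m d (s %% m))`_i = parity_coef a m d (m * i.+1 - s).
Proof.
move=> m0; rewrite coefXnM coef_poly; have E := divn_eq s m; have L := ltn_pmod s m0.
have [lt_i|ge_i] := ltnP i (s %/ m).
  rewrite /parity_coef (_ : m * i.+1 - s = 0)%N //.
  have : (i.+1 * m <= s %/ m * m)%N by rewrite leq_mul2r lt_i orbT.
  lia.
have {ge_i} [j ->] : exists j, i = (j + s %/ m)%N by exists (i - s %/ m)%N; rewrite subnK.
have -> : (m * (j + s %/ m).+1 - s = m * j.+1 - s %% m)%N.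
  by rewrite {2}E -addSn mulnDr [(m * (s %/ m))%N]mulnC; lia.
rewrite addnK; case: ltnP => // gt_d; rewrite /parity_coef [in X in _ && X]leqNgt.
suff -> : (m * d.+1 < m * j.+1 - s %% m)%N by rewrite andbF.
have : (m * d.+2 <= m * j.+1)%N by rewrite leq_mul2l; lia.
by rewrite !mulnS; lia.
Qed.

Definition parity_row : 'cV[{poly F}]_n := \col_c parity_poly n delta c.

Let ME : M = (q * n + r)%N. Proof. rewrite /M /delta /n; lia. Qed.

Lemma parity_coef_unit u : (0 < u <= n * delta.+1)%N -> parity_coef a n delta u != 0.
Proof.
move=> u_ok; rewrite /parity_coef u_ok expf_neq0 //.
(* The 1 by 1 minor at column 0 is a positive power of [a], so [a] is nonzero. *)
have := @superregular 1 (fun=> 0%N) isT.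
rewrite /admissible; have -> : [forall j : 'I_1, 0 < n * j.+1]%N by apply/forallP.
have -> : [forall i : 'I_1, forall j : 'I_1, (i < j) ==> (0 < 0)]%N.
  by apply/forallP => i; apply/forallP => j; rewrite !ord1.
rewrite det_mx11 mxE /parity_coef; case: ifP => [_|]; last by rewrite eqxx => _ /(_ isT).
by move=> /(_ isT); apply: contraNneq => ->; rewrite expr0n.
Qed.

Lemma size_parity_row c : size (parity_row c 0) = delta.+1.
Proof.
rewrite mxE size_poly_eq //= parity_coef_unit //.
by have := ltn_ord c; rewrite -/n => ltc; rewrite mulnS; lia.
Qed.

(** The invertible minor on the first M + 1 columns prescribes the coefficients up to D^M. These
    columns are q full blocks of n and r + 1 more, hence the size bounds. *)
Lemma parity_row_surj (f : {poly F}) : (size f <= M.+1)%N ->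
  exists w : 'rV[{poly F}]_n, w *m parity_row = f%:M /\
    forall c, (size (w 0%R c) <= q + (c <= r))%N.
Proof.
move=> sz_f; pose A := minor_mx a n delta (fun j : 'I_M.+1 => j).
have Aunit : A \in unitmx.
  rewrite unitmxE unitfE superregular //.
  apply/admissibleP; split=> // j; rewrite mulnS mulnDl; lia.
pose y := invmx A *m \col_i f`_i.
have Ay : A *m y = \col_i f`_i by rewrite mulKVmx.
have Mq (j : 'I_M.+1) : (j %/ n <= q)%N.
  by rewrite -ltnS ltn_divLR //; have := ltn_ord j; rewrite /M /delta /n; lia.
pose w : 'rV[{poly F}]_n := \row_c \sum_(j : 'I_M.+1 | (j %% n)%N == c) y j 0 *: 'X^(j %/ n).
exists w; split=> [|c]; last first.
  rewrite mxE; apply: leq_trans (size_sum _ _ _) _; apply/bigmax_leqP => j /eqP jc.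
  apply: leq_trans (size_scale_leq _ _) _; rewrite size_polyXn.
  case: (leqP c r) => rc; first by rewrite addn1 ltnS Mq.
  rewrite addn0 ltnNge; apply/negP => qj.
  have : (q * n <= j %/ n * n)%N by rewrite leq_mul2r qj orbT.
  have := divn_eq j n; rewrite jc; have := ltn_ord j; have := ME.
  move: (j %/ n)%N (nat_of_ord j) => u v; move: (M) (n) (nat_of_ord c) rc => m n' c' rc; lia.
have wE : (w *m parity_row) 0 0 =
    \sum_(j < M.+1) y j 0 *: ('X^(j %/ n) * parity_poly n delta (j %% n)).
  rewrite mxE; under eq_bigr => c _ do rewrite !mxE mulr_suml.
  rewrite (exchange_big_dep predT) //=; apply: eq_bigr => j _.
  rewrite (big_pred1 (Ordinal (ltn_pmod j (isT : 0 < n)%N))); first by rewrite scalerAl.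
  by move=> c; rewrite /= eq_sym -val_eqE.
apply/matrixP => i j; rewrite !ord1 [RHS]mxE eqxx mulr1n wE; apply/polyP => l.
rewrite coef_sum.
under eq_bigr => s _ do rewrite coefZ coef_parity_poly_shift //.
have [lt_l|ge_l] := ltnP l M.+1.
  have /matrixP/(_ (Ordinal lt_l) 0) := Ay; rewrite [in RHS]mxE mxE /= => <-.
  by apply: eq_bigr => s _; rewrite [A _ _]mxE mulrC.
(* Beyond row M the columns s <= M have left the band, since n (l + 1) - s > n (delta + 1). *)
rewrite nth_default ?(leq_trans sz_f) // big1 // => s _.
rewrite /parity_coef; case: ifP => [/andP[_]|]; last by rewrite mulr0.
rewrite leqNgt => /negP[]; have := ltn_ord s.
have : (n * M.+2 <= n * l.+1)%N by rewrite leq_mul2l; lia.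
rewrite /M /delta /n; lia.
Qed.

Lemma parity_row_bezout : exists b : 'rV[{poly F}]_n, b *m parity_row = 1%:M.
Proof. by have [|b []] := @parity_row_surj 1; [rewrite size_poly1 | exists b]. Qed.

(* The last clause makes the leading coefficient matrix of these rows, without
   its column 0, lower unitriangular. *)
Lemma parity_kernel_row (t : 'I_k) : exists g : 'rV[{poly F}]_n,
  [/\ g *m parity_row = 0,
      forall c, (size (g 0%R c) <= (q + (t < r)).+1)%N &
      forall t' : 'I_k, (t <= t')%N -> (g 0 (lift 0 t'))`_(q + (t < r)) = (t' == t)%:R].
Proof.
set e := (t < r)%N; pose h := parity_row; pose c : 'I_n := lift 0 t.
(* For a row of degree q + 1, [beta] removes the coefficient of D^delta, so that D^(q + e) d still
   has degree at most M. *)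
pose beta := if e then (h c 0)`_delta / (h 0 0)`_delta else 0.
have lead0 : (h 0 0)`_delta != 0.
  have -> : (h 0 0)`_delta = lead_coef (h 0 0) by rewrite /lead_coef size_parity_row.
  by rewrite lead_coef_eq0 -size_poly_eq0 size_parity_row.
pose d := h c 0 - beta *: h 0 0.
have sz_d : (size d <= delta.+1 - e)%N.
  apply/leq_sizeP => j; rewrite leq_subLR coefB coefZ => le_j.
  have [lt_j|] := ltnP delta j.
    by rewrite !nth_default ?size_parity_row // mulr0 subr0.
  move: le_j; rewrite /beta; case: (e) => /= le_j ge_j; last by lia.
  have -> : j = delta by lia.
  by rewrite divfK ?subrr.
have [|w [wh sz_w]] := @parity_row_surj ('X^(q + e) * d).
  have [->|d0] := eqVneq d 0; first by rewrite mulr0 size_poly0.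
  rewrite size_monicM ?monicXn // size_polyXn /=; apply: leq_trans (leq_add (leqnn _) sz_d) _.
  by rewrite /M; case: (e) => /=; lia.
pose u : 'rV[{poly F}]_n := 'X^(q + e) *: (delta_mx 0 c - beta%:P *: delta_mx 0 0).
exists (u - w); split.
- apply/matrixP => i j; rewrite !ord1 mulmxBl wh -scalemxAl mulmxBl -scalemxAl.
  by rewrite -!rowE !mxE eqxx mulr1n /d -mul_polyC !mxE subrr.
- move=> c'; rewrite !mxE; apply: leq_trans (size_polyD _ _) _.
  rewrite size_polyN geq_max; apply/andP; split; last first.
    by apply: leq_trans (sz_w c') _; case: (_ <= r)%N => /=; lia.
  apply: leq_trans (size_polyMleq _ _) _; rewrite size_polyXn /= -[X in (_ <= X)%N]addn1 leq_add2l.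
  have -> : 1 = 1%:P :> {poly F} by [].
  case: (_ == _); case: (_ == _); rewrite ?mulr1 ?mulr0 ?subr0 ?sub0r /= -?polyCB -?polyCN;
  by rewrite ?size_polyC_leq1 ?size_poly0.
- move=> t' le_t; rewrite !mxE coefB coefXnM ltnn subnn.
  (* [lift 0 t'] has index t' + 1, and t' + 1 <= r implies t < r as t <= t'; so [w] has no term of
     degree q + e there. *)
  rewrite [(w _ _)`_ _]nth_default ?subr0.
    rewrite (inj_eq lift_inj) [lift _ _ == 0]eq_sym (negbTE (neq_lift _ _)) mulr0 subr0.
    by case: (_ == t); rewrite ?coef1 ?coef0.
  apply: leq_trans (sz_w _) _; rewrite leq_add2l /e /=.
  by rewrite /bump /= add1n; case: ltnP => // ; case: ltnP => //; lia.
Qed.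

Lemma parity_nkd_code : nkd_code k delta (parity_code parity_row).
Proof.
have [b bh] := parity_row_bezout; have [g g_ok] := fin_all_exists parity_kernel_row.
pose G : 'M_(k, 1 + k) := \matrix_t g t.
have GE t c : G t c = g t 0 c by rewrite mxE.
suff : [/\ minimal_generator (parity_code parity_row) G, basic G & sum_row_degrees G = delta].
  move=> G_ok; split; last by exists G.
  by split; [lia | exists G; case: G_ok => -[]].
apply: (@parity_minimal_basic _ _ _ _ _ bh size_parity_row _ (fun t : 'I_k => q + (t < r))%N).
- apply/row_matrixP => t; rewrite row_mul rowK row0.
  by have [] := g_ok t.
- by move=> t c; rewrite GE; have [] := g_ok t.
- rewrite big_split /= sum_nat_const card_ord; congr (_ + _)%N.
  rewrite -[RHS]card_ord -sum1_card (big_ord_widen _ (fun=> 1%N) (ltnW r_lt)).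
  by rewrite [RHS]big_mkcond; apply: eq_bigr => i _; case: (i < r)%N.
- rewrite det_trig.
    apply/prodf_neq0 => t _; rewrite mxE GE; have [_ _ ->] := g_ok t; last exact: leqnn.
    by rewrite eqxx oner_eq0.
  apply/is_trig_mxP => t t' lt_t; rewrite mxE GE; have [_ _ ->] := g_ok t; last exact: ltnW.
  by rewrite -val_eqE /= gtn_eqF.
Qed.

(** * Column distance *)

Lemma poly_act_parity (x : int -> F) c i : (forall j, j < 0 -> x j = 0) -> (i <= M)%N ->
  poly_act (parity_row c 0) x i%:Z =
  \sum_(m < M.+1) parity_coef a n delta (n * i.+1 - (m * n + c)) * x m%:Z.
Proof.
move=> x_neg le_i; set p := parity_row c 0.
have coefE m : parity_coef a n delta (n * i.+1 - (m * n + c)) = ('X^m * p)`_i.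
  rewrite -coef_parity_poly_shift // divnMDl // modnMDl modn_small ?ltn_ord //.
  by rewrite divn_small ?ltn_ord // addn0 /p mxE.
rewrite (@poly_actE _ (i.+1 + size p)) ?leq_addl // big_split_ord /=.
rewrite [X in _ + X]big1 ?addr0 => [|m _]; last by rewrite x_neg ?mulr0 //; lia.
rewrite (reindex_inj rev_ord_inj) /=.
transitivity (\sum_(m < M.+1 | (m < i.+1)%N) ('X^m * p)`_i * x m%:Z); last first.
  rewrite big_mkcond; apply: eq_bigr => m _; rewrite coefE coefXnM ltnS leqNgt.
  by case: ltnP => //=; rewrite mul0r.
rewrite -(big_ord_widen _ (fun m => ('X^m * p)`_i * x m%:Z)) //.
apply: eq_bigr => m _; rewrite coefXnM ltnNge -ltnS ltn_ord subSS /=; congr (_ * x _).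
by have := ltn_ord m; lia.
Qed.

Lemma column_distance_ge (v : 'I_n -> laurent F) :
  parity_code parity_row v -> has_delay v 0 -> (M.+2 <= wt (initial_segment v M))%N.
Proof.
move=> vC [[c0 vc0] v_neg]; rewrite leqNgt ltnS; apply/negP => le_wt.
pose S := [set ic : 'I_M.+1 * 'I_n | v ic.2 (ic.1 : nat)%:Z != 0].
have wtS : wt (initial_segment v M) = #|S|.
  by apply: eq_card => ic; rewrite !inE mxE.
pose code (ic : 'I_M.+1 * 'I_n) := (ic.1 * n + ic.2)%N.
pose x s := v (inord (s %% n)) (s %/ n)%:Z.
have xE ic : x (code ic) = v ic.2 (ic.1 : nat)%:Z.
  rewrite /x /code divnMDl // modnMDl modn_small ?ltn_ord // divn_small ?ltn_ord // addn0.
  by congr (v _ _); apply: inord_val.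
have code_inj : injective code.
  move=> [i c] [i' c']; rewrite /code /= => E.
  have := congr1 (divn^~ n) E; have := congr1 (modn^~ n) E.
  rewrite /= !divnMDl // !modnMDl !modn_small ?ltn_ord // !divn_small ?ltn_ord // !addn0.
  by move=> /val_inj -> /val_inj ->.
pose ss := sort leq [seq code ic | ic <- enum S].
have ss_sorted : sorted ltn ss.
  rewrite ltn_sorted_uniq_leq sort_uniq map_inj_uniq // enum_uniq /=.
  exact: sort_sorted leq_total _.
have size_ss : (size ss <= M.+1)%N by rewrite size_sort size_map -cardE -wtS.
have mem_ss s : s \in ss -> x s != 0.
  by rewrite mem_sort => /mapP[ic]; rewrite mem_enum inE => icS ->; rewrite xE.
have syndrome i : (i <= M)%N ->
    \sum_(s <- ss) parity_coef a n delta (n * i.+1 - s) * x s = 0.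
  move=> le_i; rewrite -[RHS](vC i%:Z).
  rewrite (perm_big [seq code ic | ic <- enum S]); last by rewrite perm_sort.
  rewrite big_map big_enum /=.
  under [RHS]eq_bigr => c _ do rewrite (poly_act_parity _ (fun j jl => v_neg j jl c) le_i).
  rewrite exchange_big pair_big /= big_mkcond; apply: eq_bigr => ic _; rewrite xE inE.
  by case: eqVneq => //= ->; rewrite mulr0.
have c0_ss : (c0 : nat) \in ss.
  by rewrite mem_sort; apply/mapP; exists (ord0, c0) => //; rewrite mem_enum inE.
have nth_lt := sorted_ltn_nth ltn_trans 0%N ss_sorted.
have head_lt : (nth 0 ss 0 < n)%N.
  have := c0_ss; rewrite -index_mem => lt_c0; apply: leq_ltn_trans (ltn_ord c0).
  rewrite -[X in (_ <= X)%N](nth_index 0%N c0_ss).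
  have [->//|i_gt0] := posnP (index (c0 : nat) ss).
  by apply/ltnW/nth_lt => //; rewrite inE (leq_ltn_trans _ lt_c0).
have ss_gt0 : (0 < size ss)%N by case: (ss) c0_ss.
(* The least such [t] is where the support first leaves the admissible range, or ends. It is
   positive because delay 0 puts a position below n. *)
pose stop t := (t == size ss) || (n * t.+1 <= nth 0 ss t)%N.
have : exists t, stop t by exists (size ss); rewrite /stop eqxx.
case/ex_minnP => t stop_t min_t.
have le_t : (t <= size ss)%N by rewrite min_t // /stop eqxx.
have t_gt0 : (0 < t)%N.
  rewrite lt0n; apply: contraTneq stop_t => ->.
  by rewrite /stop negb_or muln1 -ltnNge head_lt andbT eq_sym -lt0n.
have adm : admissible n (fun j : 'I_t => nth 0%N ss j).
  apply/admissibleP; split=> [i j ij|j].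
    by apply: nth_lt ij; rewrite inE (leq_trans (ltn_ord _)).
  by rewrite ltnNge; apply: contraTN (ltn_ord j) => le_j; rewrite -leqNgt min_t // /stop le_j orbT.
have := superregular (leq_trans le_t size_ss) adm.
set A := minor_mx _ _ _ _ => detA.
have Aunit : A \in unitmx by rewrite unitmxE unitfE.
have : A *m (\col_j x (nth 0%N ss j)) = 0.
  apply/matrixP => i j; rewrite !mxE.
  have le_i : (i <= M)%N by rewrite -ltnS (leq_trans (ltn_ord i)) // (leq_trans le_t).
  rewrite -[RHS](syndrome i le_i) (big_nth 0%N) big_mkord.
  pose f l := parity_coef a n delta (n * i.+1 - nth 0%N ss l) * x (nth 0%N ss l).
  transitivity (\sum_(l < t) f l); first by apply: eq_bigr => l _; rewrite !mxE.
  rewrite (big_ord_widen _ f le_t) big_mkcond; apply: eq_bigr => l _.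
  (* Support positions from index t on are at least n (t + 1), hence above the band in the first t
     rows. *)
  case: ltnP => // le_l; rewrite /parity_coef (_ : _ - _ = 0)%N ?mul0r //.
  have lt_t : (t < size ss)%N by apply: leq_ltn_trans le_l (ltn_ord l).
  move: stop_t; rewrite /stop ltn_eqF //= => le_nth; apply/eqP; rewrite subn_eq0.
  apply: leq_trans (_ : n * t.+1 <= _)%N; first by rewrite leq_mul2l ltnS ltnW ?orbT.
  apply: leq_trans le_nth _; have [->//|ne] := eqVneq t l.
  by apply/ltnW/nth_lt; rewrite ?inE // ltn_neqAle ne.
move=> /(congr1 (mulmx (invmx A))); rewrite mulKmx // mulmx0.
move=> /matrixP/(_ (Ordinal t_gt0) 0); rewrite !mxE /= => x0.
by have := mem_ss (nth 0%N ss 0) (mem_nth 0%N ss_gt0); rewrite x0 eqxx.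
Qed.

(** Up to time M, take 1 in coordinate 1 and -h_1 / h_0 in coordinate 0: the window then holds at
    most 1 + (M + 1) nonzero entries. *)
Lemma light_codeword : exists v, [/\ parity_code parity_row v, has_delay v 0 &
  (wt (initial_segment v M) <= M.+2)%N].
Proof.
have [b bh] := parity_row_bezout; set h := parity_row in bh *.
have k_gt0 : (0 < k)%N by lia.
pose c1 : 'I_n := lift 0 (Ordinal k_gt0).
have h00 : (h 0 0)`_0 != 0.
  rewrite mxE coef_poly /= parity_coef_unit //.
  by rewrite muln1 mulnS; lia.
have : coprimep (h 0 0) ('X^(M.+1)).
  by apply: coprimep_expr; rewrite coprimepX /root horner_coef0.
(* [f] inverts h_0 modulo D^(M + 1). *)
case/Bezout_eq1_coprimepP => -[f s] /= fs.
have {fs} fs : f * h 0 0 = 1 - s * 'X^(M.+1) by rewrite -fs addrK.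
pose x : 'rV[{poly F}]_n := delta_mx 0 c1 - (f * h c1 0) *: delta_mx 0 0.
(* The product x h is h_1 s D^(M + 1); subtracting that multiple of [b] gives a codeword that agrees
   with [x] up to time M. *)
pose w := x - (h c1 0 * s * 'X^(M.+1)) *: b.
have wh : w *m h = 0.
  clearbody h; apply/matrixP => i j; rewrite !ord1 !mulmxBl -!scalemxAl bh -!rowE !mxE eqxx mulr1.
  rewrite [f * _ * _]mulrAC fs; ring.
pose v c := series_of_poly (w 0 c).
have vE c (i : nat) : (i <= M)%N -> v c i%:Z = (x 0 c)`_i.
  have -> : v c i%:Z = (w 0 c)`_i by [].
  clearbody x h; move=> le_i; rewrite !mxE mulrAC coefB coefMXn ltnS le_i subr0.
  by [].
have x_c1 : x 0 c1 = 1 by rewrite !mxE !eqxx /= mulr0 subr0.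
have x_other c : c != 0 -> c != c1 -> x 0 c = 0.
  by move=> /negbTE c_0 /negbTE c_1; rewrite !mxE c_0 c_1 /= mulr0 subr0.
exists v; split.
- exact/parity_code_poly.
- split; last by case.
  by exists c1; rewrite (vE c1 0%N) // x_c1 coef1 oner_eq0.
- have -> : wt (initial_segment v M) = #|[set ic : 'I_M.+1 * 'I_n | (x 0 ic.2)`_ic.1 != 0]|.
    by apply: eq_card => ic; rewrite !inE mxE vE // -ltnS.
  apply: (@leq_trans #|(ord0, c1) |: [set (i, 0 : 'I_n) | i : 'I_M.+1]|).
    apply/subset_leq_card/subsetP => -[i c]; rewrite !inE /= => x_ne.
    have [->|c_0] := eqVneq c 0; first by rewrite imset_f ?orbT.
    have [c_1|c_1] := eqVneq c c1; last by rewrite x_other ?coef0 ?eqxx in x_ne.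
    move: x_ne; rewrite c_1 x_c1 coef1; have [i0 _|] := eqVneq (i : nat) 0%N; last by rewrite eqxx.
    by rewrite xpair_eqE eqxx andbT -val_eqE /= i0 eqxx.
  rewrite cardsU1 -[M.+2]add1n leq_add ?leq_b1 //.
  by apply: leq_trans (leq_imset_card _ _) _; rewrite card_ord.
Qed.

Lemma parity_column_distance : column_distance (parity_code parity_row) M M.+2.
Proof.
split; last exact: column_distance_ge.
have [v [vC v0 le_wt]] := light_codeword; exists v; split=> //.
by apply/eqP; rewrite eqn_leq le_wt column_distance_ge.
Qed.

End ParityRow.

Theorem theorem3p10 (n delta p : nat) (hn : 2 <= n) (hdelta : 1 <= delta)
    (hp : prime p) :
  exists (F : finFieldType) (C : series_set F n),
    (p \in [pchar F]%R) /\ strongly_MDS (n - 1) delta C.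
Proof.
case: n hn => [//|k] k_gt0; rewrite ltnS in k_gt0.
set q := delta %/ k; set r := delta %% k.
have deltaE : delta = k * q + r by rewrite mulnC -divn_eq.
have r_lt : r < k by rewrite ltn_pmod.
have [|F [a [pF sup]]] := @exists_superregular p k.+1 (k * q + r) (k * q + r + q) hp.
  by rewrite /=; move: q r r_lt {deltaE} => q r r_lt; nia.
exists F, (parity_code (parity_row a k q r)); split=> //.
(* In codimension 1 the ceiling is [delta] itself, so the window index is M = delta + q and the
   required distance is M + 2. *)
rewrite /strongly_MDS subn1 /= subSnn /ceil_div divn1 addn0 mul1n -/q deltaE; split.
  exact: parity_nkd_code.
rewrite [q + (_ + r)]addnC (_ : q + 1 + _ + 1 = (k * q + r + q).+2); last by lia.
exact: parity_column_distance.
Qed.
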